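(* Let $n\ge 1$ be an integer, $0<\alpha\le 1$, $\beta>0$, let $(a,b)\subseteq(0,\infty)$ be an open interval, and let $p_0,p_1,\dots,p_{n-1},f:(a,b)\to\mathbb{R}$ be such that the functions $\Gamma(\beta+1)t^{\alpha-1}p_{n-1}(t),\dots,\Gamma(\beta+1)t^{\alpha-1}p_1(t),\Gamma(\beta+1)t^{\alpha-1}p_0(t),\Gamma(\beta+1)t^{\alpha-1}f(t)$ are continuous on $(a,b)$. Let $t_0\in(a,b)$ and $y_0,y_1,\dots,y_{n-1}\in\mathbb{R}$. Then there exists on $(a,b)$ a solution $y$, and it is unique, of the initial value problem $${}^{n}D^{\alpha,\beta}_{M}y+p_{n-1}(t)\,{}^{n-1}D^{\alpha,\beta}_{M}y+\dots+p_{1}(t)\,D^{\alpha,\beta}_{M}y+p_{0}(t)\,y=f(t),$$ $$y(t_0)=y_0,\quad D^{\alpha,\beta}_{M}y(t_0)=y_1,\quad\dots,\quad {}^{n-1}D^{\alpha,\beta}_{M}y(t_0)=y_{n-1},$$ where a solution means an $n$ times $M$-differentiable function $y:(a,b)\to\mathbb{R}$ satisfying the equation on $(a,b)$ and the initial conditions.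
   Context: For $\beta>0$, $\mathbb{E}_\beta(z)=\sum_{k=0}^{\infty}\frac{z^k}{\Gamma(\beta k+1)}$ is the one-parameter Mittag-Leffler function. For $0<\alpha\le 1$, $\beta>0$, the $M$-fractional derivative of order $\alpha$ of a function $f$ at a point $t>0$ is $$D^{\alpha,\beta}_{M}f(t)=\lim_{\epsilon\to0}\frac{f\big(t\,\mathbb{E}_\beta(\epsilon t^{-\alpha})\big)-f(t)}{\epsilon},$$ and $f$ is called $M$-differentiable at $t$ if this limit exists. ${}^{k}D^{\alpha,\beta}_{M}y=D^{\alpha,\beta}_{M}D^{\alpha,\beta}_{M}\cdots D^{\alpha,\beta}_{M}y$ ($k$ times) denotes the sequential (iterated) $M$-derivative, and $y$ is $n$ times $M$-differentiable if these exist for $k=1,\dots,n$ on the interval. *)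

(* Defs.v *)
From Stdlib Require Import Reals.
From Coquelicot Require Import Coquelicot.
Open Scope R_scope.

(* Euler's integral, which converges for [x > 0]. *)
Definition Gamma (x : R) : R :=
  RInt_gen (fun s => Rpower s (x - 1) * exp (- s))
    (at_right 0) (Rbar_locally p_infty).

Definition mittag_leffler (beta z : R) : R :=
  PSeries (fun k => / Gamma (beta * INR k + 1)) z.

(* Functions on an open interval [(a, b)] are represented by total functions
   [R -> R]: all the notions below are local, so that on [(a, b)] they do not
   depend on the values taken outside [(a, b)]. *)

Definition Mquotient (alpha beta : R) (f : R -> R) (t eps : R) : R :=
  (f (t * mittag_leffler beta (eps * Rpower t (- alpha))) - f t) / eps.

Definition ex_Mderive (alpha beta : R) (f : R -> R) (t : R) : Prop :=
  ex_finite_lim (Mquotient alpha beta f t) 0.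

(* Meaningful only where [ex_Mderive] holds. *)
Definition Mderive (alpha beta : R) (f : R -> R) (t : R) : R :=
  real (Lim (Mquotient alpha beta f t) 0).

Fixpoint Mderive_n (alpha beta : R) (k : nat) (f : R -> R) : R -> R :=
  match k with
  | O => f
  | S k => Mderive alpha beta (Mderive_n alpha beta k f)
  end.

Definition in_itv (a b : Rbar) (t : R) : Prop := Rbar_lt a t /\ Rbar_lt t b.

Definition Mdifferentiable_n (alpha beta : R) (n : nat) (a b : Rbar)
    (y : R -> R) : Prop :=
  forall k, (k < n)%nat -> forall t, in_itv a b t ->
    ex_Mderive alpha beta (Mderive_n alpha beta k y) t.

(* Only [p 0, ..., p (n - 1)] and [y0 0, ..., y0 (n - 1)] are used; [n >= 1]. *)
Definition is_solution (alpha beta : R) (n : nat) (a b : Rbar)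
    (p : nat -> R -> R) (f : R -> R) (t0 : R) (y0 : nat -> R)
    (y : R -> R) : Prop :=
  Mdifferentiable_n alpha beta n a b y /\
  (forall t, in_itv a b t ->
     Mderive_n alpha beta n y t
     + sum_n (fun i => p i t * Mderive_n alpha beta i y t) (n - 1) = f t) /\
  (forall k, (k < n)%nat -> Mderive_n alpha beta k y t0 = y0 k).

(* Main.v *)
Require Import Defs.
From Stdlib Require Import Reals Lra Lia Classical_Prop.
From Coquelicot Require Import Coquelicot.
Open Scope R_scope.

(** The M-derivative is an ordinary derivative in disguise. The Mittag-Leffler
    series has bounded coefficients, since [Gamma] is bounded below by a positive
    constant on [[1, +oo)], so near [0] it is a smooth function with value [1] and
    derivative [1 / Gamma (beta + 1)]. The M-quotient of [f] at [t > 0] therefore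
    compares [f t] with the values of [f] along a curve through [t] of positive
    speed [t^(1 - alpha) / Gamma (beta + 1)], and [f] is M-differentiable at [t] if
    and only if it is differentiable there, with
    [f' t = w t * D_M f t], [w t = Gamma (beta + 1) * t^(alpha - 1)]
    ([is_lim_Mquotient]). That M-differentiability implies differentiability is
    the less evident half; it rests on the intermediate value theorem
    ([is_lim_quotient_reparam]).

    Consequently [y] solves the equation if and only if the vector of its
    sequential M-derivatives solves a first-order linear system, whose
    coefficients [w], [w * p_i] and [w * f] are the functions assumed continuous
    ([solves_of_is_solution], [Mderive_n_of_solves]). Such a system is Lipschitz
    in the unknown, uniformly on compact subintervals
    ([companion_field_lipschitz]). The Picard iteration, measured in a norm
    weighted by a hyperbolic cosine for which each step halves distances
    ([cosh_contraction]), gives a unique solution on the whole interval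
    ([system_existence], [system_uniqueness]). *)

(** * Euler's integral and the Mittag-Leffler function *)

(** Integrals of a nonnegative function over [[u, v]] grow with the interval, so
    boundedness alone makes them converge, to their supremum; the supremum is
    then an upper bound of each of them, which yields lower bounds on the
    improper integral. *)
Lemma improper_integral_of_bounded (g : R -> R) (M : R) :
  (forall x, 0 < x -> continuous g x) ->
  (forall x, 0 < x -> 0 <= g x) ->
  (forall u v, 0 < u < v -> RInt g u v <= M) ->
  exists l, is_RInt_gen g (at_right 0) (Rbar_locally p_infty) l /\
    forall u v, 0 < u < v -> RInt g u v <= l.
Proof.
  intros gc gpos gM.
  assert (gint : forall u v, 0 < u -> 0 < v -> ex_RInt g u v).
  { intros u v hu hv. apply (ex_RInt_continuous (V := R_CompleteNormedModule)).
    intros z hz. apply gc. apply Rlt_le_trans with (2 := proj1 hz).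
    now apply Rmin_glb_lt. }
  assert (gmono : forall u u' v v', 0 < u' <= u -> u < v <= v' ->
            RInt g u v <= RInt g u' v').
  { intros u u' v v' hu hv.
    assert (E : RInt g u' v' = RInt g u' u + (RInt g u v + RInt g v v')).
    { rewrite <- (RInt_Chasles g u' u v') by (apply gint; lra).
      rewrite <- (RInt_Chasles g u v v') by (apply gint; lra).
      reflexivity. }
    assert (0 <= RInt g u' u).
    { apply RInt_ge_0; [lra | apply gint; lra | intros; apply gpos; lra]. }
    assert (0 <= RInt g v v').
    { apply RInt_ge_0; [lra | apply gint; lra | intros; apply gpos; lra]. }
    lra. }
  destruct (completeness (fun r => exists u v, 0 < u < v /\ r = RInt g u v))
    as [l [lub1 lub2]].
  { exists M. intros r (u & v & huv & ->). now apply gM. }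
  { exists (RInt g 1 2), 1, 2. split; [lra | reflexivity]. }
  assert (hle : forall u v, 0 < u < v -> RInt g u v <= l).
  { intros u v huv. apply lub1. now exists u, v. }
  exists l. split; [| exact hle].
  intros P [eps hP].
  assert (exists u v, 0 < u < v /\ l - eps < RInt g u v) as (u & v & huv & hl).
  { destruct (classic
      (exists u v, 0 < u < v /\ l - eps < RInt g u v)) as [H | H]; [exact H |].
    exfalso. assert (l <= l - eps); [| destruct eps; simpl in *; lra].
    apply lub2. intros r (u & v & huv & ->). apply Rnot_lt_le. intros h.
    apply H. now exists u, v. }
  apply (Filter_prod _ _ _ (fun x => 0 < x <= u) (fun y => v <= y)).
  - exists (mkposreal u (proj1 huv)). intros x hx hx0.
    unfold ball in hx. simpl in hx. unfold AbsRing_ball, abs, minus, plus, opp in hx.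
    simpl in hx. apply Rabs_def2 in hx. lra.
  - exists v. intros; lra.
  - intros x y hx hy. simpl. exists (RInt g x y). split.
    + apply (RInt_correct (V := R_CompleteNormedModule)). apply gint; lra.
    + apply hP. unfold ball. simpl. unfold AbsRing_ball, abs, minus, plus, opp.
      simpl. assert (RInt g x y <= l) by (apply hle; lra).
      assert (RInt g u v <= RInt g x y) by (apply gmono; lra).
      apply Rabs_def1; lra.
Qed.

Lemma continuous_Rpower (x y : R) :
  0 < x -> continuous (fun s => Rpower s y) x.
Proof.
  intros hx. apply (ex_derive_continuous (K := R_AbsRing) (V := R_NormedModule)).
  eexists. apply is_derive_Reals. now apply derivable_pt_lim_power.
Qed.

Lemma continuous_exp_scal (c x : R) : continuous (fun s => exp (c * s)) x.
Proof.
  apply (ex_derive_continuous (K := R_AbsRing) (V := R_NormedModule)).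
  auto_derive. trivial.
Qed.

Lemma exp_nondecreasing (x y : R) : x <= y -> exp x <= exp y.
Proof.
  intros [h | ->]; [now apply Rlt_le, exp_increasing | apply Rle_refl].
Qed.

(** Half of the exponential decay of [exp (- s)] absorbs the power: from
    [ln z <= z - 1] at [z = x / (2 p + 1)]. *)
Lemma Rpower_le_exp (p x : R) : 0 <= p -> 0 < x ->
  Rpower x p <= Rpower (2 * p + 1) p * exp (x / 2).
Proof.
  intros hp hx. unfold Rpower. rewrite <- exp_plus. apply exp_nondecreasing.
  assert (h : ln (x / (2 * p + 1)) <= x / (2 * p + 1)).
  { assert (0 < x / (2 * p + 1)) by (apply Rdiv_lt_0_compat; lra).
    assert (1 + ln (x / (2 * p + 1)) <= x / (2 * p + 1)); [| lra].
    rewrite <- (exp_ln (x / (2 * p + 1))) at 2 by assumption.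
    apply exp_ineq1_le. }
  rewrite ln_div in h by lra.
  assert (p * (ln x - ln (2 * p + 1)) <= p * (x / (2 * p + 1)))
    by (apply Rmult_le_compat_l; lra).
  assert (p * (x / (2 * p + 1)) <= x / 2); [| lra].
  apply Rmult_le_reg_r with (2 * p + 1); [lra |].
  field_simplify; [| lra]. nra.
Qed.

(** A bound away from [0], uniform on [[1, +oo)], bounds the coefficients of the
    Mittag-Leffler series. It comes from the part of the integral over [[1, 2]],
    where the integrand is at least [exp (- 2)]. *)
Lemma Gamma_lower_bound (x : R) : 1 <= x -> exp (- 2) <= Gamma x.
Proof.
  intros hx.
  set (g := fun s => Rpower s (x - 1) * exp (- s)).
  set (C := Rpower (2 * (x - 1) + 1) (x - 1)).
  assert (hC : 0 < C) by apply exp_pos.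
  assert (gc : forall s, 0 < s -> continuous g s).
  { intros s hs. apply (continuous_mult (K := R_AbsRing)).
    - now apply continuous_Rpower.
    - apply continuous_ext with (fun s => exp (- (1) * s)).
      + intros; f_equal; ring.
      + apply continuous_exp_scal. }
  assert (gpos : forall s, 0 < s -> 0 <= g s).
  { intros s _. apply Rlt_le, Rmult_lt_0_compat; apply exp_pos. }
  destruct (improper_integral_of_bounded g (2 * C) gc gpos) as (l & hl & hle).
  - intros u v huv.
    assert (I : is_RInt (fun s => C * exp (- (1/2) * s)) u v
                  (minus (- (2 * C) * exp (- (1/2) * v))
                         (- (2 * C) * exp (- (1/2) * u)))).
    { apply (is_RInt_derive (fun s => - (2 * C) * exp (- (1/2) * s))).
      - intros s _. auto_derive; [trivial | field].
      - intros s _. apply (continuous_mult (K := R_AbsRing)).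
        + apply continuous_const.
        + apply continuous_exp_scal. }
    apply Rle_trans with (RInt (fun s => C * exp (- (1/2) * s)) u v).
    + apply RInt_le; [lra | | eexists; exact I |].
      * apply (ex_RInt_continuous (V := R_CompleteNormedModule)).
        intros z hz. apply gc. rewrite Rmin_left in hz by lra; lra.
      * intros s hs. unfold g.
        replace (- (1/2) * s) with (s / 2 + - s) by field.
        rewrite exp_plus, <- Rmult_assoc. apply Rmult_le_compat_r.
        -- apply Rlt_le, exp_pos.
        -- apply Rpower_le_exp; lra.
    + rewrite (is_RInt_unique _ _ _ _ I). unfold minus, plus, opp; simpl.
      assert (0 < exp (- (1/2) * v)) by apply exp_pos.
      assert (exp (- (1/2) * u) <= 1).
      { rewrite <- exp_0 at 2. apply exp_nondecreasing. lra. }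
      nra.
  - assert (E : Gamma x = l).
    { unfold Gamma. apply (is_RInt_gen_unique (V := R_CompleteNormedModule)).
      exact hl. }
    rewrite E. apply Rle_trans with (2 := hle 1 2 ltac:(lra)).
    replace (exp (-2)) with (RInt (fun _ => exp (-2)) 1 2).
    2:{ rewrite RInt_const. unfold scal; simpl. unfold mult; simpl. ring. }
    apply RInt_le; [lra | apply ex_RInt_const | |].
    + apply (ex_RInt_continuous (V := R_CompleteNormedModule)).
      intros z hz. apply gc. rewrite Rmin_left in hz by lra; lra.
    + intros s hs. unfold g.
      assert (1 <= Rpower s (x - 1)).
      { rewrite <- (Rpower_O s) at 1 by lra. apply Rle_Rpower; lra. }
      assert (exp (-2) <= exp (- s)) by (apply exp_nondecreasing; lra).
      assert (0 < exp (-2)) by apply exp_pos.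
      nra.
Qed.

Lemma Gamma_1 : Gamma 1 = 1.
Proof.
  unfold Gamma. apply (is_RInt_gen_unique (V := R_CompleteNormedModule)).
  assert (D : forall x, is_derive (fun s : R => - exp (- s)) x (exp (- x))).
  { intros x. auto_derive; [trivial | ring]. }
  apply (is_RInt_gen_ext (Derive (fun s => - exp (- s)))).
  { apply (Filter_prod _ _ _ (fun x => 0 < x) (fun x => 0 < x)).
    - exists (mkposreal 1 Rlt_0_1). intros; assumption.
    - exists 0. auto.
    - simpl. intros u v hu hv x hx.
      rewrite (is_derive_unique _ _ _ (D x)), Rminus_diag, Rpower_O.
      + ring.
      + apply Rlt_trans with (2 := proj1 hx). now apply Rmin_glb_lt. }
  assert (E : 1 = 0 - (-1)) by ring. rewrite E.
  apply is_RInt_gen_Derive.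
  - exists (fun _ => True) (fun _ => True); try apply filter_true.
    intros. eexists. apply D.
  - exists (fun _ => True) (fun _ => True); try apply filter_true.
    intros. apply continuous_ext with (fun s => exp (- (1) * s)).
    + intros s. rewrite (is_derive_unique _ _ _ (D s)). f_equal; ring.
    + apply continuous_exp_scal.
  - replace (-1) with (- exp (- 0)) by (rewrite Ropp_0, exp_0; reflexivity).
    intros P HP.
    assert (H : continuous (fun s : R => - exp (- s)) 0).
    { apply (ex_derive_continuous (K := R_AbsRing) (V := R_NormedModule)).
      eexists. apply D. }
    specialize (H P HP). unfold filtermap, at_right, within in *.
    revert H. apply filter_imp. auto.
  - change (is_lim (fun s => - exp (- s)) p_infty 0).
    replace (Finite 0) with (Rbar_opp 0) by (simpl; f_equal; ring).
    apply is_lim_opp.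
    apply (is_lim_comp exp Ropp p_infty 0 m_infty).
    + apply is_lim_exp_m.
    + apply (is_lim_opp (fun x => x) p_infty p_infty). apply is_lim_id.
    + exists 0. intros. discriminate.
Qed.

(** The coefficients are bounded by [exp 2]. The M-derivative looks at the germ of
    the series at [0], for which a radius of at least [1] suffices. *)
Lemma mittag_leffler_radius (beta : R) : 0 < beta ->
  Rbar_le 1 (CV_radius (fun k => / Gamma (beta * INR k + 1))).
Proof.
  intros hbeta. apply CV_radius_bounded. exists (exp 2). intros k.
  assert (hG : exp (- 2) <= Gamma (beta * INR k + 1)).
  { apply Gamma_lower_bound. pose proof (pos_INR k). nra. }
  assert (h2 : 0 < exp (- 2)) by apply exp_pos.
  rewrite pow1, Rmult_1_r, Rabs_pos_eq.
  - rewrite <- (Ropp_involutive 2), exp_Ropp. now apply Rinv_le_contravar.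
  - apply Rlt_le, Rinv_0_lt_compat. lra.
Qed.

Lemma mittag_leffler_0 (beta : R) : mittag_leffler beta 0 = 1.
Proof.
  unfold mittag_leffler. rewrite PSeries_0. simpl.
  rewrite Rmult_0_r, Rplus_0_l, Gamma_1. apply Rinv_1.
Qed.

Lemma ex_derive_mittag_leffler (beta z : R) : 0 < beta -> Rabs z < 1 ->
  ex_derive (mittag_leffler beta) z.
Proof.
  intros hbeta hz. eexists. apply is_derive_PSeries.
  apply Rbar_lt_le_trans with (Finite 1); [exact hz |].
  now apply mittag_leffler_radius.
Qed.

Lemma is_derive_mittag_leffler_0 (beta : R) : 0 < beta ->
  is_derive (mittag_leffler beta) 0 (/ Gamma (beta + 1)).
Proof.
  intros hbeta.
  replace (/ Gamma (beta + 1)) with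
    (PSeries (PS_derive (fun k => / Gamma (beta * INR k + 1))) 0).
  - apply is_derive_PSeries.
    apply Rbar_lt_le_trans with (Finite 1);
      [simpl; rewrite Rabs_R0; lra | now apply mittag_leffler_radius].
  - rewrite PSeries_0. unfold PS_derive. simpl. now rewrite Rmult_1_l, Rmult_1_r.
Qed.

(** * The M-derivative is a weighted derivative *)

Lemma is_lim_0_spec (g : R -> R) (l : R) :
  is_lim g 0 l <-> forall eps, 0 < eps -> exists delta, 0 < delta /\
    forall e, e <> 0 -> Rabs e < delta -> Rabs (g e - l) < eps.
Proof.
  rewrite <- is_lim_spec. split.
  - intros H eps heps. destruct (H (mkposreal eps heps)) as [d hd].
    exists d. split; [apply cond_pos |]. intros e he hed. apply hd; [| exact he].
    unfold ball; simpl; unfold AbsRing_ball, abs, minus, plus, opp; simpl.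
    now rewrite Ropp_0, Rplus_0_r.
  - intros H eps. destruct (H eps (cond_pos eps)) as (d & hd & hl).
    exists (mkposreal d hd). intros e he he0. apply hl; [exact he0 |].
    unfold ball in he; simpl in he.
    unfold AbsRing_ball, abs, minus, plus, opp in he; simpl in he.
    now rewrite Ropp_0, Rplus_0_r in he.
Qed.

Lemma is_derive_small_o (g : R -> R) (x l : R) :
  is_derive g x l <-> forall eps, 0 < eps -> exists delta, 0 < delta /\
    forall h, Rabs h < delta -> Rabs (g (x + h) - g x - l * h) <= eps * Rabs h.
Proof.
  rewrite is_derive_Reals. split.
  - intros H eps heps. destruct (H eps heps) as [d hd].
    exists d. split; [apply cond_pos |]. intros h hh.
    destruct (Req_dec h 0) as [-> | h0].
    + rewrite Rplus_0_r, Rabs_R0. replace (g x - g x - l * 0) with 0 by ring.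
      rewrite Rabs_R0. lra.
    + replace (g (x + h) - g x - l * h)
        with (((g (x + h) - g x) / h - l) * h) by (now field).
      rewrite Rabs_mult. apply Rmult_le_compat_r; [apply Rabs_pos |].
      apply Rlt_le. now apply hd.
  - intros H eps heps. destruct (H (eps / 2) ltac:(lra)) as (d & hd & hl).
    exists (mkposreal d hd). intros h h0 hh.
    replace ((g (x + h) - g x) / h - l)
      with ((g (x + h) - g x - l * h) / h) by (now field).
    assert (hp : 0 < Rabs h) by (now apply Rabs_pos_lt).
    rewrite Rabs_div by assumption. specialize (hl h hh).
    apply Rmult_lt_reg_r with (Rabs h); [assumption |].
    unfold Rdiv. rewrite Rmult_assoc, Rinv_l by lra. nra.
Qed.

(** Moving along a curve [phi] with nonzero speed tests differentiability just as
    well as moving along the line. From right to left this is the chain rule.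
    From left to right, every point [phi 0 + s] near [phi 0] has to be reached
    by [phi]: the intermediate value theorem provides a parameter [e], and
    [phi' 0 > 0] forces [e = O(s)]. *)
Lemma is_lim_quotient_reparam (phi f : R -> R) (mu l : R) :
  0 < mu -> is_derive phi 0 mu ->
  (exists r, 0 < r /\ forall e, Rabs e < r -> continuity_pt phi e) ->
  is_lim (fun e => (f (phi e) - f (phi 0)) / e) 0 l <->
  is_derive f (phi 0) (l / mu).
Proof.
  intros hmu hphi (r & hr & hcont). split; intros H.
  - rewrite is_lim_0_spec in H. rewrite is_derive_small_o.
    rewrite is_derive_small_o in hphi.
    intros eps heps.
    set (e1 := eps * mu / 4).
    assert (he1 : 0 < e1) by (unfold e1; apply Rdiv_lt_0_compat; nra).
    destruct (H e1 he1) as (d1 & hd1 & Hf).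
    (* [e1] and [e2] make the two error terms at [e], each at most [e1 * |e|],
       add up to [eps * |s|] once [|e| <= (2 / mu) * |s|]. *)
    set (e2 := eps * mu / 4 / (Rabs (l / mu) + 1)).
    assert (hl : 0 <= Rabs (l / mu)) by apply Rabs_pos.
    assert (he2 : 0 < e2) by (apply Rdiv_lt_0_compat; [apply he1 | lra]).
    destruct (hphi (Rmin e2 (mu / 2))) as (d2 & hd2 & Hphi).
    { apply Rmin_glb_lt; lra. }
    set (d := Rmin r (Rmin d1 d2) / 2).
    assert (hd : 0 < d /\ d < r /\ d < d1 /\ d < d2).
    { unfold d. pose proof (Rmin_l r (Rmin d1 d2)).
      pose proof (Rmin_r r (Rmin d1 d2)).
      pose proof (Rmin_l d1 d2). pose proof (Rmin_r d1 d2).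
      assert (0 < Rmin r (Rmin d1 d2)) by (repeat apply Rmin_glb_lt; assumption).
      lra. }
    assert (Hphi' : forall e, Rabs e <= d ->
      Rabs (phi e - phi 0 - mu * e) <= e2 * Rabs e /\
      Rabs (phi e - phi 0 - mu * e) <= mu / 2 * Rabs e).
    { intros e he. assert (He := Hphi e ltac:(lra)). rewrite Rplus_0_l in He.
      pose proof (Rmin_l e2 (mu / 2)). pose proof (Rmin_r e2 (mu / 2)).
      pose proof (Rabs_pos e). split; nra. }
    exists (mu * d / 2). split; [nra |]. intros s hs.
    apply Rabs_def2 in hs.
    assert (exists e, Rabs e <= d /\ phi e = phi 0 + s) as (e & hed & he).
    { destruct (Ranalysis5.IVT_interv (fun e => phi e - (phi 0 + s)) (- d) d)
        as (e & he & hes).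
      - intros x hx. apply continuity_pt_minus.
        + apply hcont. apply Rabs_def1; lra.
        + apply continuity_pt_const. intros ? ?. reflexivity.
      - lra.
      - destruct (Hphi' (- d)) as [_ h].
        { rewrite Rabs_Ropp, Rabs_pos_eq; lra. }
        rewrite Rabs_Ropp, (Rabs_pos_eq d) in h by lra.
        apply Rabs_le_between in h. nra.
      - destruct (Hphi' d) as [_ h].
        { rewrite Rabs_pos_eq; lra. }
        rewrite (Rabs_pos_eq d) in h by lra.
        apply Rabs_le_between in h. nra.
      - exists e. split; [apply Rabs_le; lra | lra]. }
    destruct (Hphi' e hed) as [h1 h2]. rewrite he in h1, h2.
    replace (phi 0 + s - phi 0 - mu * e) with (s - mu * e) in h1, h2 by ring.
    (* The bound [h2] reads [|s - mu e| <= (mu / 2) |e|]. *)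
    assert (hes : Rabs e <= 2 / mu * Rabs s).
    { assert (hme : Rabs (mu * e) <= Rabs s + Rabs (s - mu * e)).
      { rewrite <- (Rabs_Ropp (s - mu * e)).
        replace (Rabs (mu * e)) with (Rabs (s + - (s - mu * e)))
          by (f_equal; ring).
        apply Rabs_triang. }
      rewrite Rabs_mult, (Rabs_pos_eq mu) in hme by lra.
      apply Rmult_le_reg_l with mu; [assumption |].
      replace (mu * (2 / mu * Rabs s)) with (2 * Rabs s) by (field; lra). lra. }
    assert (h3 : Rabs (f (phi e) - f (phi 0) - l * e) <= e1 * Rabs e).
    { destruct (Req_dec e 0) as [-> | e0].
      - replace (f (phi 0) - f (phi 0) - l * 0) with 0 by ring.
        rewrite Rabs_R0. lra.
      - replace (f (phi e) - f (phi 0) - l * e)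
          with (((f (phi e) - f (phi 0)) / e - l) * e) by (now field).
        rewrite Rabs_mult. apply Rmult_le_compat_r; [apply Rabs_pos |].
        apply Rlt_le, Hf; [exact e0 | lra]. }
    rewrite <- he.
    replace (f (phi e) - f (phi 0) - l / mu * s) with
      ((f (phi e) - f (phi 0) - l * e) + - ((l / mu) * (s - mu * e)))
      by (field; lra).
    apply Rle_trans with (1 := Rabs_triang _ _).
    rewrite Rabs_Ropp, Rabs_mult.
    assert (h4 : Rabs (l / mu) * Rabs (s - mu * e) <= e1 * Rabs e).
    { apply Rle_trans with (Rabs (l / mu) * (e2 * Rabs e)).
      - now apply Rmult_le_compat_l.
      - rewrite <- Rmult_assoc. apply Rmult_le_compat_r; [apply Rabs_pos |].
        assert (E : e1 = e2 * (Rabs (l / mu) + 1))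
          by (unfold e1, e2; field; lra).
        rewrite E. nra. }
    apply Rle_trans with (2 * (e1 * Rabs e)); [lra |].
    apply Rle_trans with (2 * (e1 * (2 / mu * Rabs s))).
    + apply Rmult_le_compat_l; [lra |]. apply Rmult_le_compat_l; lra.
    + right. unfold e1. field. lra.
  - assert (D : is_derive (fun e => f (phi e)) 0 l).
    { replace l with (scal mu (l / mu)).
      - now apply (is_derive_comp f phi).
      - unfold scal; simpl; unfold mult; simpl. field. lra. }
    rewrite is_lim_0_spec. apply is_derive_Reals in D.
    intros eps heps. destruct (D eps heps) as [d hd].
    exists d. split; [apply cond_pos |]. intros e he hed.
    specialize (hd e he hed). now rewrite Rplus_0_l in hd.
Qed.

(** The factor [w] for which [y' = w * D_M y]. *)
Definition weight (alpha beta t : R) : R :=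
  Gamma (beta + 1) * Rpower t (alpha - 1).

Lemma Gamma_beta_pos (beta : R) : 0 < beta -> 0 < Gamma (beta + 1).
Proof.
  intros hbeta. apply Rlt_le_trans with (exp (- 2)); [apply exp_pos |].
  apply Gamma_lower_bound. lra.
Qed.

Lemma weight_pos (alpha beta t : R) : 0 < beta -> 0 < weight alpha beta t.
Proof.
  intros hbeta. apply Rmult_lt_0_compat; [now apply Gamma_beta_pos | apply exp_pos].
Qed.

(** The curve [e |-> t * E_beta (e * t^(- alpha))] starts at [t] with speed
    [t^(1 - alpha) / Gamma (beta + 1)], the inverse of the weight. *)
Lemma is_lim_Mquotient (alpha beta t l : R) (f : R -> R) :
  0 < beta -> 0 < t ->
  is_lim (Mquotient alpha beta f t) 0 l <->
  is_derive f t (weight alpha beta t * l).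
Proof.
  intros hbeta ht.
  set (k := Rpower t (- alpha)).
  assert (hk : 0 < k) by apply exp_pos.
  assert (hG := Gamma_beta_pos beta hbeta).
  set (phi := fun e => t * mittag_leffler beta (e * k)).
  assert (phi0 : phi 0 = t).
  { unfold phi. rewrite Rmult_0_l, mittag_leffler_0. ring. }
  set (mu := / weight alpha beta t).
  assert (hw := weight_pos alpha beta t hbeta).
  assert (D : is_derive phi 0 mu).
  { replace mu with (t * (k * / Gamma (beta + 1))).
    - apply is_derive_scal.
      apply (is_derive_comp (mittag_leffler beta) (fun e => e * k)).
      + rewrite Rmult_0_l. now apply is_derive_mittag_leffler_0.
      + auto_derive; [trivial | ring].
    - unfold mu, weight, k.
      assert (E : t * Rpower t (- alpha) = / Rpower t (alpha - 1)).
      { rewrite <- (Rpower_1 t) at 1 by assumption.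
        rewrite <- Rpower_plus, <- Rpower_Ropp. f_equal. ring. }
      rewrite <- Rmult_assoc, E. field. split; [| lra].
      apply Rgt_not_eq, exp_pos. }
  assert (hc : exists r, 0 < r /\ forall e, Rabs e < r -> continuity_pt phi e).
  { exists (/ k). split; [now apply Rinv_0_lt_compat |]. intros e he.
    apply continuity_pt_filterlim.
    apply (ex_derive_continuous (K := R_AbsRing) (V := R_NormedModule) phi).
    apply ex_derive_scal.
    apply (ex_derive_comp (mittag_leffler beta) (fun e => e * k)).
    - apply ex_derive_mittag_leffler; [assumption |].
      rewrite Rabs_mult, (Rabs_pos_eq k) by lra.
      apply Rmult_lt_reg_r with (/ k); [now apply Rinv_0_lt_compat |].
      rewrite Rmult_assoc, Rinv_r by lra. lra.
    - auto_derive. trivial. }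
  assert (hmu : 0 < mu) by (now apply Rinv_0_lt_compat).
  pose proof (is_lim_quotient_reparam phi f mu l hmu D hc) as H.
  rewrite phi0 in H. unfold Mquotient. unfold phi in H.
  replace (weight alpha beta t * l) with (l / mu)
    by (unfold mu; field; lra).
  exact H.
Qed.

Lemma is_derive_of_ex_Mderive (alpha beta t : R) (f : R -> R) :
  0 < beta -> 0 < t -> ex_Mderive alpha beta f t ->
  is_derive f t (weight alpha beta t * Mderive alpha beta f t).
Proof.
  intros hbeta ht [l hl]. apply is_lim_Mquotient; [assumption .. |].
  unfold Mderive. now rewrite (is_lim_unique _ _ _ hl).
Qed.

Lemma Mderive_of_is_derive (alpha beta t l : R) (f : R -> R) :
  0 < beta -> 0 < t -> is_derive f t (weight alpha beta t * l) ->
  ex_Mderive alpha beta f t /\ Mderive alpha beta f t = l.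
Proof.
  intros hbeta ht D. apply is_lim_Mquotient in D; [| assumption ..]. split.
  - now exists l.
  - unfold Mderive. now rewrite (is_lim_unique _ _ _ D).
Qed.

(** * Lipschitz systems on an open interval *)

Lemma in_itv_convex (a b : Rbar) (c d t : R) :
  in_itv a b c -> in_itv a b d -> c <= t <= d -> in_itv a b t.
Proof.
  intros [hc _] [_ hd] [h1 h2]. split.
  - now apply Rbar_lt_le_trans with (Finite c).
  - now apply Rbar_le_lt_trans with (Finite d).
Qed.

Lemma in_itv_open (a b : Rbar) : open (in_itv a b).
Proof. apply open_and; [apply open_Rbar_gt | apply open_Rbar_lt]. Qed.

Lemma in_itv_enlarge (a b : Rbar) (t : R) : in_itv a b t ->
  exists c d, in_itv a b c /\ in_itv a b d /\ c < t < d.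
Proof.
  intros ht. destruct (in_itv_open a b t ht) as [e he].
  pose proof (cond_pos e).
  exists (t - e / 2), (t + e / 2). repeat split; try lra;
    apply he; unfold ball; simpl; unfold AbsRing_ball, abs, minus, plus, opp;
    simpl; apply Rabs_def1; lra.
Qed.

Lemma in_itv_compact_pair (a b : Rbar) (s t : R) :
  in_itv a b s -> in_itv a b t ->
  exists c d, in_itv a b c /\ in_itv a b d /\ c < s < d /\ c < t < d.
Proof.
  intros hs ht.
  destruct (in_itv_enlarge a b s hs) as (c1 & d1 & hc1 & hd1 & h1).
  destruct (in_itv_enlarge a b t ht) as (c2 & d2 & hc2 & hd2 & h2).
  exists (Rmin c1 c2), (Rmax d1 d2).
  pose proof (Rmin_l c1 c2). pose proof (Rmin_r c1 c2).
  pose proof (Rmax_l d1 d2). pose proof (Rmax_r d1 d2).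
  repeat split; try lra; try (apply Rmin_case; apply hc1 || apply hc2);
    try (apply Rmax_case; apply hd1 || apply hd2).
Qed.

Lemma common_bound (n : nat) (P : nat -> R -> Prop) :
  (forall i M M', M <= M' -> P i M -> P i M') ->
  (forall i, (i < n)%nat -> exists M, P i M) ->
  exists M, 0 <= M /\ forall i, (i < n)%nat -> P i M.
Proof.
  intros mono. induction n as [| n IH]; intros H.
  - exists 0. split; [lra | intros; lia].
  - destruct IH as (M1 & hM1 & H1). { intros; apply H; lia. }
    destruct (H n) as (M2 & H2). { lia. }
    exists (Rmax M1 M2). split.
    + apply Rle_trans with (1 := hM1). apply Rmax_l.
    + intros i hi. destruct (Nat.eq_dec i n) as [-> | hin].
      * apply mono with (2 := H2). apply Rmax_r.
      * apply mono with (M1); [apply Rmax_l | apply H1; lia].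
Qed.

Lemma continuous_bounded (g : R -> R) (c d : R) :
  (forall t, c <= t <= d -> continuous g t) ->
  exists M, 0 <= M /\ forall t, c <= t <= d -> Rabs (g t) <= M.
Proof.
  intros H. destruct (bounded_continuity (V := R_NormedModule) g c d H) as [M hM].
  exists (Rmax M 0). split; [apply Rmax_r |].
  intros t ht. apply Rle_trans with M; [| apply Rmax_l].
  apply Rlt_le. exact (hM t ht).
Qed.

Lemma continuous_of_is_derive (g : R -> R) (t l : R) :
  is_derive g t l -> continuous g t.
Proof.
  intros D. apply (ex_derive_continuous (K := R_AbsRing) (V := R_NormedModule)).
  now exists l.
Qed.

(** By the mean value theorem, [phi t - g t] and [phi t + g t] vanish or have
    the sign of [t - t0]. Stating the bound with [Rabs (phi t)] covers both sides of
    [t0] at once. *)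
Lemma Rabs_le_of_derive_le (g dg phi dphi : R -> R) (c d t0 t : R) :
  c <= t0 <= d -> c <= t <= d -> g t0 = 0 -> phi t0 = 0 ->
  (forall s, c <= s <= d -> is_derive g s (dg s)) ->
  (forall s, c <= s <= d -> is_derive phi s (dphi s)) ->
  (forall s, c <= s <= d -> Rabs (dg s) <= dphi s) ->
  Rabs (g t) <= Rabs (phi t).
Proof.
  intros ht0 ht g0 phi0 Dg Dphi hle.
  assert (hin : forall s, Rmin t0 t <= s <= Rmax t0 t -> c <= s <= d).
  { intros s hs. revert hs. apply Rmin_case; apply Rmax_case; lra. }
  assert (D1 : forall s, c <= s <= d ->
    is_derive (fun x => phi x - g x) s (dphi s - dg s)).
  { intros s hs. apply (is_derive_minus phi g); auto. }
  assert (D2 : forall s, c <= s <= d ->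
    is_derive (fun x => phi x + g x) s (dphi s + dg s)).
  { intros s hs. apply (is_derive_plus phi g); auto. }
  destruct (MVT_gen (fun x => phi x - g x) t0 t (fun s => dphi s - dg s))
    as (s1 & hs1 & E1).
  { intros s hs. apply D1, hin. lra. }
  { intros s hs. apply continuity_pt_filterlim.
    apply continuous_of_is_derive with (1 := D1 s (hin s hs)). }
  destruct (MVT_gen (fun x => phi x + g x) t0 t (fun s => dphi s + dg s))
    as (s2 & hs2 & E2).
  { intros s hs. apply D2, hin. lra. }
  { intros s hs. apply continuity_pt_filterlim.
    apply continuous_of_is_derive with (1 := D2 s (hin s hs)). }
  assert (h1 := hle s1 (hin s1 hs1)). assert (h2 := hle s2 (hin s2 hs2)).
  apply Rabs_le_between in h1. apply Rabs_le_between in h2.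
  rewrite g0, phi0 in E1, E2.
  destruct (Rle_lt_dec t0 t) as [h | h].
  - assert (0 <= (dphi s1 - dg s1) * (t - t0)) by (apply Rmult_le_pos; lra).
    assert (0 <= (dphi s2 + dg s2) * (t - t0)) by (apply Rmult_le_pos; lra).
    rewrite (Rabs_pos_eq (phi t)) by lra. apply Rabs_le. lra.
  - assert (0 <= (dphi s1 - dg s1) * (t0 - t)) by (apply Rmult_le_pos; lra).
    assert (0 <= (dphi s2 + dg s2) * (t0 - t)) by (apply Rmult_le_pos; lra).
    rewrite (Rabs_left1 (phi t)) by lra. apply Rabs_le. lra.
Qed.

Lemma cosh_ge_1 (x : R) : 1 <= cosh x.
Proof.
  unfold cosh. pose proof (exp_ineq1_le x). pose proof (exp_ineq1_le (- x)). lra.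
Qed.

Lemma Rabs_sinh_le_cosh (x : R) : Rabs (sinh x) <= cosh x.
Proof.
  unfold sinh, cosh. pose proof (exp_pos x). pose proof (exp_pos (- x)).
  apply Rabs_le. lra.
Qed.

(** The contraction behind existence and uniqueness. In the norm weighted by
    [cosh (2 K (t - t0))], integration from [t0] of a [K]-Lipschitz function of
    [x] halves distances, because [cosh] dominates its own primitive [sinh].
    The weight is smooth and serves on both sides of [t0], and the factor
    [1 / 2] does not depend on the length of [[c, d]]: hence solutions are
    obtained on the whole interval at once, with no gluing of local ones. *)
Lemma cosh_contraction (K B c d t0 t : R) (g dg : R -> R) :
  0 < K -> 0 <= B -> c <= t0 <= d -> c <= t <= d -> g t0 = 0 ->
  (forall s, c <= s <= d -> is_derive g s (dg s)) ->
  (forall s, c <= s <= d ->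
     Rabs (dg s) <= K * (B * cosh (2 * K * (s - t0)))) ->
  Rabs (g t) <= B / 2 * cosh (2 * K * (t - t0)).
Proof.
  intros hK hB ht0 ht g0 Dg hle.
  apply Rle_trans with (Rabs (B / 2 * sinh (2 * K * (t - t0)))).
  - apply (Rabs_le_of_derive_le g dg (fun s => B / 2 * sinh (2 * K * (s - t0)))
      (fun s => K * (B * cosh (2 * K * (s - t0)))) c d t0 t); auto.
    + rewrite Rminus_diag, Rmult_0_r, sinh_0. ring.
    + intros s _. unfold sinh, cosh. auto_derive; [trivial | unfold Rminus; field].
  - rewrite Rabs_mult, (Rabs_pos_eq (B / 2)) by lra.
    apply Rmult_le_compat_l; [lra | apply Rabs_sinh_le_cosh].
Qed.

(** The right-hand sides to which the Picard iteration applies on the whole of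
    [(a, b)]. Vectors are functions on [nat] of which the entries below [n]
    count. Lipschitz in the sup norm, globally in [x] and uniformly for [t] in
    compact subintervals, so that solutions cannot blow up inside [(a, b)]. *)
Definition lipschitz_field (n : nat) (a b : Rbar)
    (F : nat -> R -> (nat -> R) -> R) : Prop :=
  (forall (v : nat -> R -> R) t, in_itv a b t ->
     (forall j, (j < n)%nat -> continuous (v j) t) ->
     forall i, (i < n)%nat -> continuous (fun s => F i s (fun j => v j s)) t) /\
  (forall c d, in_itv a b c -> in_itv a b d ->
     exists K, 0 < K /\ forall i t x x' B, (i < n)%nat -> c <= t <= d ->
       (forall j, (j < n)%nat -> Rabs (x j - x' j) <= B) ->
       Rabs (F i t x - F i t x') <= K * B).

Definition solves (n : nat) (a b : Rbar) (F : nat -> R -> (nat -> R) -> R)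
    (u : nat -> R -> R) : Prop :=
  forall i, (i < n)%nat -> forall t, in_itv a b t ->
    is_derive (u i) t (F i t (fun j => u j t)).

Lemma is_lim_seq_half_pow (Q : R) : is_lim_seq (fun m => Q * (1 / 2) ^ m) 0.
Proof.
  rewrite <- (Rmult_0_r Q) at 1.
  apply is_lim_seq_mult'.
  - apply is_lim_seq_const.
  - apply is_lim_seq_geom. rewrite Rabs_pos_eq; lra.
Qed.

Lemma le_geometric_0 (x Q : R) :
  (forall m, Rabs x <= Q * (1 / 2) ^ m) -> x = 0.
Proof.
  intros H. destruct (Req_dec x 0) as [E | E]; [exact E | exfalso].
  apply Rabs_pos_lt in E.
  assert (h : Rbar_le (Rabs x) 0).
  { apply (is_lim_seq_le (fun _ => Rabs x) (fun m => Q * (1 / 2) ^ m));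
      [exact H | apply is_lim_seq_const | apply is_lim_seq_half_pow]. }
  simpl in h. lra.
Qed.

(** The difference of two solutions vanishes at [t0] and its derivative is at most
    [K] times its sup norm; being bounded on a compact subinterval, it is
    halved by the contraction as often as one wants. *)
Lemma system_uniqueness (n : nat) (a b : Rbar)
    (F : nat -> R -> (nat -> R) -> R) (t0 : R) (u v : nat -> R -> R) :
  lipschitz_field n a b F -> in_itv a b t0 ->
  solves n a b F u -> solves n a b F v ->
  (forall i, (i < n)%nat -> u i t0 = v i t0) ->
  forall i, (i < n)%nat -> forall t, in_itv a b t -> u i t = v i t.
Proof.
  intros [_ hLip] ht0 Su Sv h0 i hi t ht.
  destruct (in_itv_compact_pair a b t0 t ht0 ht)
    as (c & d & hc & hd & h1 & h2).
  destruct (hLip c d hc hd) as (K & hK & HK).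
  assert (hin : forall s, c <= s <= d -> in_itv a b s)
    by (intros; now apply in_itv_convex with c d).
  assert (D : forall j, (j < n)%nat -> forall s, c <= s <= d ->
    is_derive (fun x => u j x - v j x) s
      (F j s (fun k => u k s) - F j s (fun k => v k s))).
  { intros j hj s hs. apply (is_derive_minus (u j) (v j)); auto. }
  destruct (common_bound n
      (fun j M => forall s, c <= s <= d -> Rabs (u j s - v j s) <= M))
    as (C & hC & HC).
  { intros j M M' hM HM s hs. apply Rle_trans with M; auto. }
  { intros j hj. destruct (continuous_bounded (fun s => u j s - v j s) c d)
      as (M & _ & HM).
    - intros s hs. apply continuous_of_is_derive with (1 := D j hj s hs).
    - now exists M. }
  assert (key : forall m j, (j < n)%nat -> forall s, c <= s <= d ->
    Rabs (u j s - v j s) <= C * (1 / 2) ^ m * cosh (2 * K * (s - t0))).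
  { induction m as [| m IH]; intros j hj s hs.
    - simpl. pose proof (cosh_ge_1 (2 * K * (s - t0))).
      apply Rle_trans with (1 := HC j hj s hs). nra.
    - replace (C * (1 / 2) ^ S m) with (C * (1 / 2) ^ m / 2) by (simpl; field).
      apply (cosh_contraction K (C * (1 / 2) ^ m) c d t0 s
               (fun x => u j x - v j x)
               (fun s => F j s (fun k => u k s) - F j s (fun k => v k s)));
        try lra; auto.
      + apply Rmult_le_pos; [lra | apply pow_le; lra].
      + rewrite h0; [ring | exact hj]. }
  apply Rminus_diag_uniq.
  apply le_geometric_0 with (C * cosh (2 * K * (t - t0))).
  intros m. replace (C * cosh (2 * K * (t - t0)) * (1 / 2) ^ m)
    with (C * (1 / 2) ^ m * cosh (2 * K * (t - t0))) by ring.
  apply key; [exact hi | lra].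
Qed.

Lemma geometric_increments (w : nat -> R) (Q : R) :
  (forall m, Rabs (w (S m) - w m) <= Q * (1 / 2) ^ m) ->
  forall m k, Rabs (w (m + k)%nat - w m) <= 2 * Q * (1 / 2) ^ m.
Proof.
  intros H m k.
  assert (h : Rabs (w (m + k)%nat - w m)
              <= 2 * Q * (1 / 2) ^ m * (1 - (1 / 2) ^ k)).
  { induction k as [| k IH].
    - rewrite Nat.add_0_r, Rminus_diag, Rabs_R0. simpl. lra.
    - rewrite Nat.add_succ_r. specialize (H (m + k)%nat).
      replace (w (S (m + k)) - w m)
        with ((w (S (m + k)) - w (m + k)%nat) + (w (m + k)%nat - w m)) by ring.
      apply Rle_trans with (1 := Rabs_triang _ _).
      rewrite pow_add in H. simpl. lra. }
  apply Rle_trans with (1 := h).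
  assert (hQ : 0 <= Q).
  { specialize (H 0%nat). pose proof (Rabs_pos (w 1%nat - w 0%nat)).
    simpl in H. lra. }
  assert (0 <= (1 / 2) ^ k) by (apply pow_le; lra).
  assert (0 <= 2 * Q * (1 / 2) ^ m)
    by (apply Rmult_le_pos; [lra | apply pow_le; lra]).
  nra.
Qed.

Lemma geometric_increments_lim (w : nat -> R) (Q : R) :
  (forall m, Rabs (w (S m) - w m) <= Q * (1 / 2) ^ m) ->
  forall m, Rabs (w m - real (Lim_seq w)) <= 2 * Q * (1 / 2) ^ m.
Proof.
  intros H. assert (hinc := geometric_increments w Q H).
  assert (hlim : is_lim_seq w (real (Lim_seq w))).
  { apply Lim_seq_correct', ex_lim_seq_cauchy_corr. intros eps.
    pose proof (is_lim_seq_half_pow (2 * Q)) as L. apply is_lim_seq_spec in L.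
    destruct (L (pos_div_2 eps)) as [N hN].
    exists N. specialize (hN N (le_n N)). simpl in hN. rewrite Rminus_0_r in hN.
    assert (Rabs (2 * Q * (1 / 2) ^ N) < eps / 2) by exact hN.
    pose proof (Rle_abs (2 * Q * (1 / 2) ^ N)).
    intros p q hp hq.
    assert (h1 := hinc N (p - N)%nat). assert (h2 := hinc N (q - N)%nat).
    replace (N + (p - N))%nat with p in h1 by lia.
    replace (N + (q - N))%nat with q in h2 by lia.
    apply Rabs_le_between in h1. apply Rabs_le_between in h2.
    apply Rabs_def1; lra. }
  intros m.
  assert (L : is_lim_seq (fun k => Rabs (w (k + m)%nat - w m))
                (Rabs (real (Lim_seq w) - w m))).
  { apply (is_lim_seq_abs _ (Finite (real (Lim_seq w) - w m))).
    apply is_lim_seq_minus'; [| apply is_lim_seq_const].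
    now apply (is_lim_seq_incr_n w m). }
  assert (h : Rbar_le (Rabs (real (Lim_seq w) - w m)) (2 * Q * (1 / 2) ^ m)).
  { apply (is_lim_seq_le (fun k => Rabs (w (k + m)%nat - w m))
             (fun _ => 2 * Q * (1 / 2) ^ m)); [| exact L | apply is_lim_seq_const].
    intros k. rewrite Nat.add_comm. apply hinc. }
  rewrite Rabs_minus_sym. exact h.
Qed.

Lemma CVU_dom_geometric (fn : nat -> R -> R) (D : R -> Prop) (Q : R) :
  (forall m x, D x -> Rabs (fn (S m) x - fn m x) <= Q * (1 / 2) ^ m) ->
  CVU_dom fn D.
Proof.
  intros H eps.
  pose proof (is_lim_seq_half_pow (2 * Q)) as L. apply is_lim_seq_spec in L.
  destruct (L eps) as [N hN]. exists N. intros m hm x hx.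
  specialize (hN m hm). simpl in hN. rewrite Rminus_0_r in hN.
  assert (h := geometric_increments_lim (fun k => fn k x) Q
                 (fun k => H k x hx)).
  apply Rle_lt_trans with (1 := h m).
  apply Rle_lt_trans with (2 := hN). apply Rle_abs.
Qed.

Fixpoint picard (F : nat -> R -> (nat -> R) -> R) (t0 : R) (x0 : nat -> R)
    (m : nat) : nat -> R -> R :=
  match m with
  | O => fun i _ => x0 i
  | S m => fun i t =>
      x0 i + RInt (fun s => F i s (fun j => picard F t0 x0 m j s)) t0 t
  end.

Lemma picard_init (F : nat -> R -> (nat -> R) -> R) (t0 : R) (x0 : nat -> R)
    (m i : nat) : picard F t0 x0 m i t0 = x0 i.
Proof.
  destruct m; simpl; [reflexivity |]. rewrite RInt_point. apply Rplus_0_r.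
Qed.

Lemma is_derive_primitive (g : R -> R) (a b : Rbar) (t0 t k : R) :
  in_itv a b t0 -> in_itv a b t ->
  (forall s, in_itv a b s -> continuous g s) ->
  is_derive (fun x => k + RInt g t0 x) t (g t).
Proof.
  intros ht0 ht hg. replace (g t) with (0 + g t) by ring.
  apply (is_derive_plus (fun _ => k) (fun x => RInt g t0 x)).
  - exact (is_derive_const (K := R_AbsRing) (V := R_NormedModule) k t).
  - apply (is_derive_RInt g (fun x => RInt g t0 x) t0 t); [| now apply hg].
    apply filter_imp with (2 := in_itv_open a b t ht). intros s hs.
    apply (RInt_correct (V := R_CompleteNormedModule)).
    apply (ex_RInt_continuous (V := R_CompleteNormedModule)).
    intros z hz. apply hg. revert hz. apply Rmin_case; apply Rmax_case; intros hz;
      first [now apply in_itv_convex with t0 s | now apply in_itv_convex with s t0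
            | now apply in_itv_convex with s s | now apply in_itv_convex with t0 t0].
Qed.

Lemma picard_continuous (n : nat) (a b : Rbar)
    (F : nat -> R -> (nat -> R) -> R) (t0 : R) (x0 : nat -> R) :
  lipschitz_field n a b F -> in_itv a b t0 ->
  forall m i, (i < n)%nat -> forall t, in_itv a b t ->
    continuous (picard F t0 x0 m i) t.
Proof.
  intros [hc _] ht0. induction m as [| m IH]; intros i hi t ht.
  - apply continuous_const.
  - simpl. eapply continuous_of_is_derive.
    apply is_derive_primitive with a b; [assumption .. |].
    intros s hs. apply hc; auto.
Qed.

Lemma picard_is_derive (n : nat) (a b : Rbar)
    (F : nat -> R -> (nat -> R) -> R) (t0 : R) (x0 : nat -> R) :
  lipschitz_field n a b F -> in_itv a b t0 ->
  forall m i, (i < n)%nat -> forall t, in_itv a b t ->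
    is_derive (picard F t0 x0 (S m) i) t
      (F i t (fun j => picard F t0 x0 m j t)).
Proof.
  intros HF ht0 m i hi t ht. simpl.
  apply (is_derive_primitive (fun s => F i s (fun j => picard F t0 x0 m j s)) a b);
    [assumption .. |].
  intros s hs. apply (proj1 HF); auto.
  intros j hj. now apply picard_continuous with n a b.
Qed.

(** Each Picard step halves the distance to the previous iterate in the weighted
    norm; on a compact subinterval the weight is bounded and drops into [Q]. *)
Lemma picard_increments (n : nat) (a b : Rbar)
    (F : nat -> R -> (nat -> R) -> R) (t0 c d : R) (x0 : nat -> R) :
  lipschitz_field n a b F -> in_itv a b c -> in_itv a b d -> c <= t0 <= d ->
  exists Q, forall m i, (i < n)%nat -> forall t, c <= t <= d ->
    Rabs (picard F t0 x0 (S m) i t - picard F t0 x0 m i t) <= Q * (1 / 2) ^ m.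
Proof.
  intros HF hc hd ht0.
  assert (hin : forall s, c <= s <= d -> in_itv a b s)
    by (intros; now apply in_itv_convex with c d).
  destruct (proj2 HF c d hc hd) as (K & hK & HK).
  set (u := picard F t0 x0).
  destruct (common_bound n
      (fun j M => forall s, c <= s <= d -> Rabs (u 1%nat j s - u 0%nat j s) <= M))
    as (C & hC & HC).
  { intros j M M' hM HM s hs. apply Rle_trans with M; auto. }
  { intros j hj.
    destruct (continuous_bounded (fun s => u 1%nat j s - u 0%nat j s) c d)
      as (M & _ & HM).
    - intros s hs.
      apply (continuous_minus (V := R_NormedModule) (u 1%nat j) (u 0%nat j));
        apply picard_continuous with n a b; auto.
    - now exists M. }
  destruct (continuous_bounded (fun s => cosh (2 * K * (s - t0))) c d)
    as (H & _ & HH).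
  { intros s _. eapply continuous_of_is_derive. unfold cosh.
    auto_derive; [trivial | reflexivity]. }
  assert (key : forall m j, (j < n)%nat -> forall s, c <= s <= d ->
    Rabs (u (S m) j s - u m j s)
      <= C * (1 / 2) ^ m * cosh (2 * K * (s - t0))).
  { induction m as [| m IH]; intros j hj s hs.
    - pose proof (cosh_ge_1 (2 * K * (s - t0))).
      apply Rle_trans with (1 := HC j hj s hs). simpl. nra.
    - replace (C * (1 / 2) ^ S m) with (C * (1 / 2) ^ m / 2) by (simpl; field).
      apply (cosh_contraction K (C * (1 / 2) ^ m) c d t0 s
               (fun x => u (S (S m)) j x - u (S m) j x)
               (fun s => F j s (fun k => u (S m) k s) - F j s (fun k => u m k s)));
        try lra; auto.
      + apply Rmult_le_pos; [lra | apply pow_le; lra].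
      + unfold u. rewrite !picard_init. ring.
      + intros x hx. apply (is_derive_minus (u (S (S m)) j) (u (S m) j));
          apply picard_is_derive with n a b; auto. }
  exists (C * H). intros m i hi t ht.
  apply Rle_trans with (1 := key m i hi t ht).
  specialize (HH t ht). pose proof (Rle_abs (cosh (2 * K * (t - t0)))).
  assert (0 <= C * (1 / 2) ^ m)
    by (apply Rmult_le_pos; [lra | apply pow_le; lra]).
  nra.
Qed.

(** The Picard iterates and their derivatives [F i t (u m)] both have geometrically
    small increments, so both sequences converge uniformly on compact
    subintervals; the limit may then be differentiated termwise, and the
    Lipschitz bound identifies the limit of the derivatives. *)
Lemma system_existence (n : nat) (a b : Rbar)
    (F : nat -> R -> (nat -> R) -> R) (t0 : R) (x0 : nat -> R) :
  lipschitz_field n a b F -> in_itv a b t0 ->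
  exists u, solves n a b F u /\ forall i, u i t0 = x0 i.
Proof.
  intros HF ht0.
  set (u := picard F t0 x0).
  exists (fun i t => real (Lim_seq (fun m => u m i t))). split.
  2:{ intros i. rewrite (Lim_seq_ext _ (fun _ => x0 i)).
      - now rewrite Lim_seq_const.
      - intros m. apply picard_init. }
  intros i hi t ht.
  destruct (in_itv_compact_pair a b t0 t ht0 ht)
    as (c & d & hc & hd & h1 & h2).
  assert (hin : forall s, c <= s <= d -> in_itv a b s)
    by (intros; now apply in_itv_convex with c d).
  destruct (proj2 HF c d hc hd) as (K & hK & HK).
  destruct (picard_increments n a b F t0 c d x0 HF hc hd ltac:(lra)) as [Q HQ].
  fold u in HQ.
  assert (D : forall m s, c <= s <= d ->
    is_derive (u (S m) i) s (F i s (fun j => u m j s))).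
  { intros m s hs. apply picard_is_derive with n a b; auto. }
  assert (DE : forall m s, c <= s <= d ->
    Derive (u (S m) i) s = F i s (fun j => u m j s)).
  { intros m s hs. apply is_derive_unique. now apply D. }
  assert (hlim : Lim_seq (fun m => Derive (u (S m) i) t)
    = F i t (fun j => real (Lim_seq (fun m => u m j t)))).
  { apply is_lim_seq_unique.
    apply is_lim_seq_ext with (fun m => F i t (fun j => u m j t)).
    { intros m. rewrite DE; [reflexivity | lra]. }
    apply is_lim_seq_spec. intros eps.
    pose proof (is_lim_seq_half_pow (K * (2 * Q))) as L.
    apply is_lim_seq_spec in L.
    destruct (L eps) as [N hN]. exists N. intros m hm. specialize (hN m hm).
    simpl in hN. rewrite Rminus_0_r in hN.
    apply Rle_lt_trans with (K * (2 * Q * (1 / 2) ^ m)).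
    - apply HK; [exact hi | lra |]. intros j hj.
      apply (geometric_increments_lim (fun m => u m j t)).
      intros k. apply HQ; [exact hj | lra].
    - rewrite <- Rmult_assoc. apply Rle_lt_trans with (2 := hN). apply Rle_abs. }
  assert (G : is_derive (fun y => real (Lim_seq (fun m => u (S m) i y))) t
                (real (Lim_seq (fun m => Derive (u (S m) i) t)))).
  { apply (CVU_Derive (fun m => u (S m) i) (fun s => c < s < d)).
    - apply open_and; [apply open_gt | apply open_lt].
    - intros x y z hx hy hz. lra.
    (* The index is shifted by one, as the initial iterate is no primitive. *)
    - apply CVU_dom_geometric with (Q / 2). intros m x hx.
      replace (Q / 2 * (1 / 2) ^ m) with (Q * (1 / 2) ^ S m) by (simpl; field).
      apply HQ; [exact hi | lra].
    - intros m x hx. eexists. apply D. lra.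
    - intros m x hx. apply continuity_pt_filterlim.
      change (continuous (Derive (u (S m) i)) x).
      apply (continuous_ext_loc _ (fun s => F i s (fun j => u m j s))).
      + assert (O : open (fun s => c < s < d))
          by (apply open_and; [apply open_gt | apply open_lt]).
        apply filter_imp with (2 := O x hx). intros s hs.
        symmetry. apply DE. lra.
      + apply (proj1 HF); [apply hin; lra | | exact hi].
        intros j hj. apply picard_continuous with n a b; auto. apply hin; lra.
    - apply CVU_dom_geometric with (K * Q). intros m x hx.
      rewrite !DE by lra. rewrite Rmult_assoc. apply HK; [exact hi | lra |].
      intros j hj. apply HQ; [exact hj | lra].
    - lra. }
  rewrite hlim in G.
  apply is_derive_ext with (2 := G).
  intros s. now rewrite (Lim_seq_incr_1 (fun m => u m i s)).
Qed.

(** * The linear equation as a first-order system *)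

Lemma Rabs_sum_n_le (g : nat -> R) (M : R) (N : nat) :
  (forall j, (j <= N)%nat -> Rabs (g j) <= M) ->
  Rabs (sum_n g N) <= INR (S N) * M.
Proof.
  induction N as [| N IH]; intros H.
  - rewrite sum_O. simpl. rewrite Rmult_1_l. apply H. lia.
  - rewrite sum_Sn, S_INR. apply Rle_trans with (1 := Rabs_triang _ _).
    rewrite Rmult_plus_distr_r, Rmult_1_l.
    apply Rplus_le_compat; [apply IH; intros; apply H; lia | apply H; lia].
Qed.

Lemma continuous_sum_n (g : nat -> R -> R) (N : nat) (t : R) :
  (forall j, (j <= N)%nat -> continuous (g j) t) ->
  continuous (fun s => sum_n (fun j => g j s) N) t.
Proof.
  induction N as [| N IH]; intros H.
  - apply continuous_ext with (g 0%nat); [intros s; now rewrite sum_O |].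
    apply H. lia.
  - apply continuous_ext with (fun s => plus (sum_n (fun j => g j s) N) (g (S N) s)).
    { intros s. now rewrite sum_Sn. }
    apply (continuous_plus (V := R_NormedModule)); [| apply H; lia].
    apply IH. intros; apply H; lia.
Qed.

Lemma continuous_weight (alpha beta t : R) : 0 < t ->
  continuous (weight alpha beta) t.
Proof.
  intros ht. apply (continuous_mult (K := R_AbsRing)).
  - apply continuous_const.
  - now apply continuous_Rpower.
Qed.

(** The first-order system satisfied by the sequential M-derivatives of a solution,
    [x_i' = w x_(i+1)] below the last index, where the equation closes the
    system. The weight is distributed over the last line because continuity is
    known for the products [w * p_j] and [w * f]. *)
Definition companion_field (alpha beta : R) (n : nat) (p : nat -> R -> R)
    (f : R -> R) (i : nat) (t : R) (x : nat -> R) : R :=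
  if Nat.eqb (S i) n
  then weight alpha beta t * f t
       - sum_n (fun j => weight alpha beta t * p j t * x j) (n - 1)
  else weight alpha beta t * x (S i).

Lemma companion_field_last (alpha beta : R) (n : nat) (p : nat -> R -> R)
    (f : R -> R) (t : R) (x : nat -> R) :
  companion_field alpha beta (S n) p f n t x
  = weight alpha beta t * (f t - sum_n (fun j => p j t * x j) n).
Proof.
  unfold companion_field. rewrite Nat.eqb_refl.
  replace (S n - 1)%nat with n by lia.
  rewrite Rmult_minus_distr_l. f_equal.
  rewrite <- (sum_n_mult_l (weight alpha beta t : R_Ring)).
  apply sum_n_ext. intros j. apply Rmult_assoc.
Qed.

Lemma companion_field_not_last (alpha beta : R) (n : nat) (p : nat -> R -> R)
    (f : R -> R) (i : nat) (t : R) (x : nat -> R) : S i <> n ->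
  companion_field alpha beta n p f i t x = weight alpha beta t * x (S i).
Proof.
  intros h. unfold companion_field. now rewrite (proj2 (Nat.eqb_neq (S i) n) h).
Qed.

Lemma companion_field_lipschitz (alpha beta : R) (n : nat) (a b : Rbar)
    (p : nat -> R -> R) (f : R -> R) :
  (forall t, in_itv a b t -> 0 < t) ->
  (forall i, (i < n)%nat -> forall t, in_itv a b t ->
     continuous (fun s => weight alpha beta s * p i s) t) ->
  (forall t, in_itv a b t -> continuous (fun s => weight alpha beta s * f s) t) ->
  lipschitz_field n a b (companion_field alpha beta n p f).
Proof.
  intros hab hp hf. split.
  - intros v t ht hv i hi. unfold companion_field.
    destruct (Nat.eqb_spec (S i) n) as [E | E].
    + apply (continuous_minus (V := R_NormedModule)
        (fun s => weight alpha beta s * f s)); [now apply hf |].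
      apply (continuous_sum_n (fun j s => weight alpha beta s * p j s * v j s)).
      intros j hj. apply (continuous_mult (K := R_AbsRing)
        (fun s => weight alpha beta s * p j s) (v j)).
      * apply hp; [lia | exact ht].
      * apply hv. lia.
    + apply (continuous_mult (K := R_AbsRing) (weight alpha beta) (v (S i))).
      * apply continuous_weight. now apply hab.
      * apply hv. lia.
  - intros c d hc hd.
    assert (hin : forall s, c <= s <= d -> in_itv a b s)
      by (intros; now apply in_itv_convex with c d).
    destruct (continuous_bounded (weight alpha beta) c d) as (W & hW & HW).
    { intros t ht. apply continuous_weight, hab, hin, ht. }
    destruct (common_bound n (fun j M => forall s, c <= s <= d ->
        Rabs (weight alpha beta s * p j s) <= M)) as (P & hP & HP).
    { intros j M M' hM HM s hs. apply Rle_trans with M; auto. }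
    { intros j hj.
      destruct (continuous_bounded (fun s => weight alpha beta s * p j s) c d)
        as (M & _ & HM); [intros; apply hp; auto | now exists M]. }
    exists (W + INR n * P + 1).
    assert (hn : 0 <= INR n * P) by (apply Rmult_le_pos; [apply pos_INR | lra]).
    split; [lra |].
    intros i t x x' B hi ht HB.
    assert (hB : 0 <= B)
      by (apply Rle_trans with (2 := HB i hi); apply Rabs_pos).
    unfold companion_field. destruct (Nat.eqb_spec (S i) n) as [E | E].
    + set (w := weight alpha beta t).
      set (S1 := sum_n (fun j => w * p j t * x j) (n - 1)).
      set (S2 := sum_n (fun j => w * p j t * x' j) (n - 1)).
      assert (ES : S1 - S2 = sum_n (fun j => w * p j t * (x j - x' j)) (n - 1)).
      { assert (E2 : S1 = plus S2 (sum_n (fun j => w * p j t * (x j - x' j)) (n - 1))).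
        { unfold S1, S2. rewrite <- sum_n_plus. apply sum_n_ext.
          intros j. unfold plus; simpl. ring. }
        rewrite E2. unfold plus; simpl. ring. }
      replace (w * f t - S1 - (w * f t - S2)) with (- (S1 - S2)) by ring.
      rewrite Rabs_Ropp, ES.
      apply Rle_trans with (INR n * (P * B)); [| nra].
      replace n with (S (n - 1)) at 2 by lia.
      apply Rabs_sum_n_le. intros j hj. rewrite Rabs_mult.
      apply Rmult_le_compat; try apply Rabs_pos.
      * apply HP; [lia | exact ht].
      * apply HB. lia.
    + rewrite <- Rmult_minus_distr_l, Rabs_mult.
      apply Rle_trans with (W * B); [| nra].
      apply Rmult_le_compat; try apply Rabs_pos; [now apply HW |].
      apply HB. lia.
Qed.

Lemma solves_of_is_solution (alpha beta : R) (n : nat) (a b : Rbar)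
    (p : nat -> R -> R) (f : R -> R) (t0 : R) (y0 : nat -> R) (y : R -> R) :
  0 < beta -> (forall t, in_itv a b t -> 0 < t) ->
  is_solution alpha beta n a b p f t0 y0 y ->
  solves n a b (companion_field alpha beta n p f)
    (fun k => Mderive_n alpha beta k y).
Proof.
  intros hbeta hab (hd & heq & _) i hi t ht.
  assert (D : is_derive (Mderive_n alpha beta i y) t
    (weight alpha beta t * Mderive_n alpha beta (S i) y t)).
  { apply is_derive_of_ex_Mderive; auto. }
  destruct (Nat.eq_dec (S i) n) as [<- | E].
  - rewrite companion_field_last.
    specialize (heq t ht). replace (S i - 1)%nat with i in heq by lia.
    rewrite <- heq. now rewrite Rplus_minus_r.
  - now rewrite companion_field_not_last.
Qed.

(** Induction on [k]: the M-derivative at a point depends on the germ only, so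
    agreement of the [k]-th sequential derivative with [u k] on the open
    interval passes to the next order. *)
Lemma Mderive_n_of_solves (alpha beta : R) (n : nat) (a b : Rbar)
    (p : nat -> R -> R) (f : R -> R) (u : nat -> R -> R) :
  0 < beta -> (forall t, in_itv a b t -> 0 < t) ->
  solves n a b (companion_field alpha beta n p f) u ->
  forall k, (k < n)%nat -> forall t, in_itv a b t ->
    Mderive_n alpha beta k (u 0%nat) t = u k t /\
    is_derive (Mderive_n alpha beta k (u 0%nat)) t
      (companion_field alpha beta n p f k t (fun j => u j t)).
Proof.
  intros hbeta hab Su k.
  assert (step : (k < n)%nat ->
    (forall t, in_itv a b t -> Mderive_n alpha beta k (u 0%nat) t = u k t) ->
    forall t, in_itv a b t -> is_derive (Mderive_n alpha beta k (u 0%nat)) t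
      (companion_field alpha beta n p f k t (fun j => u j t))).
  { intros hk H t ht. apply is_derive_ext_loc with (u k); [| now apply Su].
    apply filter_imp with (2 := in_itv_open a b t ht).
    intros s hs. symmetry. now apply H. }
  enough (val : (k < n)%nat -> forall t, in_itv a b t ->
            Mderive_n alpha beta k (u 0%nat) t = u k t) by auto.
  clear step. induction k as [| k IH]; intros hk t ht; [reflexivity |].
  apply Mderive_of_is_derive; [assumption | now apply hab |].
  rewrite <- (companion_field_not_last alpha beta n p f k t (fun j => u j t))
    by lia.
  apply is_derive_ext_loc with (u k); [| apply Su; [lia | exact ht]].
  apply filter_imp with (2 := in_itv_open a b t ht).
  intros s hs. symmetry. apply IH; [lia | exact hs].
Qed.

Theorem theorem3p2 (n : nat) (alpha beta : R) (a b : Rbar)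
    (p : nat -> R -> R) (f : R -> R) (t0 : R) (y0 : nat -> R)
    (hn : (1 <= n)%nat) (halpha : 0 < alpha <= 1) (hbeta : 0 < beta)
    (hab : forall t : R, in_itv a b t -> 0 < t)
    (hp : forall i : nat, (i < n)%nat -> forall t : R, in_itv a b t ->
       continuous (fun s : R =>
         Gamma (beta + 1) * Rpower s (alpha - 1) * p i s) t)
    (hf : forall t : R, in_itv a b t ->
       continuous (fun s : R =>
         Gamma (beta + 1) * Rpower s (alpha - 1) * f s) t)
    (ht0 : in_itv a b t0) :
  exists y : R -> R,
    is_solution alpha beta n a b p f t0 y0 y /\
    forall z : R -> R, is_solution alpha beta n a b p f t0 y0 z ->
      forall t : R, in_itv a b t -> z t = y t.
Proof.
  assert (HF := companion_field_lipschitz alpha beta n a b p f hab hp hf).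
  destruct (system_existence n a b _ t0 y0 HF ht0) as (u & Su & hu0).
  assert (HM := Mderive_n_of_solves alpha beta n a b p f u hbeta hab Su).
  assert (sol : is_solution alpha beta n a b p f t0 y0 (u 0%nat)).
  { destruct n as [| N]; [lia |].
    assert (next : forall k, (k < S N)%nat -> forall t, in_itv a b t -> exists l,
      ex_Mderive alpha beta (Mderive_n alpha beta k (u 0%nat)) t /\
      Mderive_n alpha beta (S k) (u 0%nat) t = l /\
      companion_field alpha beta (S N) p f k t (fun j => u j t)
        = weight alpha beta t * l).
    { intros k hk t ht. destruct (HM k hk t ht) as [_ D].
      set (w := weight alpha beta t).
      set (F := companion_field alpha beta (S N) p f k t (fun j => u j t)) in *.
      assert (hw : 0 < w) by now apply weight_pos.
      exists (F / w).
      assert (EF : F = w * (F / w)) by (field; lra).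
      rewrite EF in D.
      destruct (Mderive_of_is_derive alpha beta t (F / w) _ hbeta (hab t ht) D).
      auto. }
    split; [| split].
    - intros k hk t ht. destruct (next k hk t ht) as (l & h & _). exact h.
    - intros t ht. destruct (next N (Nat.lt_succ_diag_r N) t ht)
        as (l & _ & -> & E).
      rewrite companion_field_last in E.
      apply Rmult_eq_reg_l in E; [| apply Rgt_not_eq; now apply weight_pos].
      rewrite <- E. replace (S N - 1)%nat with N by lia.
      rewrite (sum_n_ext_loc (fun i => p i t * Mderive_n alpha beta i (u 0%nat) t)
                 (fun i => p i t * u i t)).
      + ring.
      + intros i hi. f_equal. apply HM; [lia | exact ht].
    - intros k hk. rewrite <- hu0. now apply HM. }
  exists (u 0%nat). split; [exact sol |].
  intros z hz.
  apply (system_uniqueness n a b _ t0 (fun k => Mderive_n alpha beta k z)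
           (fun k => Mderive_n alpha beta k (u 0%nat)) HF ht0) with (i := 0%nat).
  - now apply solves_of_is_solution with t0 y0.
  - now apply solves_of_is_solution with t0 y0.
  - intros i hi. rewrite (proj2 (proj2 hz)), (proj2 (proj2 sol)); auto.
  - lia.
Qed.
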